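(* Let $G$ be a closed subset of $[0,1]\times[0,1]$ and $G^{-1}=\{(x,y):(y,x)\in G\}$. Then $\operatorname{ent}(G)=\operatorname{ent}(G^{-1})$.
   Context: Let $I=[0,1]$; open intervals in $I$ are open relative to $I$. A minimal open cover of $I$ by open intervals is a finite collection $\alpha=\{\alpha_1,\dots,\alpha_n\}$ of open intervals covering $I$ such that no subcollection of smaller cardinality covers $I$. For a closed set $A\subset I\times I$ and a positive integer $m$, let $\star_{i=1}^m A=\{(x_0,\dots,x_m)\in I^{m+1}:(x_{i-1},x_i)\in A\text{ for }1\le i\le m\}$ and $\mathbf{A}=\star_{i=1}^\infty A=\{(x_0,x_1,\dots)\in I^\infty:(x_{i-1},x_i)\in A\text{ for all }i\ge1\}$. Let $\alpha^{m+1}=\{\alpha_{k_0}\times\cdots\times\alpha_{k_m}: k_j\in\{1,\dots,n\}\}$, and let $N(K,\mathcal U)$ be the least cardinality of a subcollection of $\mathcal U$ covering $K$. If $\mathbf{A}\neq\emptyset$, define $\operatorname{ent}(A,\alpha)=\lim_{m\to\infty}\frac1m\log N(\star_{i=1}^mA,\alpha^{m+1})$ (the limit exists); if $\mathbf{A}=\emptyset$, define $\operatorname{ent}(A,\alpha)=0$. Finally $\operatorname{ent}(A)=\sup_\alpha\operatorname{ent}(A,\alpha)\in[0,\infty]$, the supremum being over all minimal open covers $\alpha$ of $I$ by open intervals. *)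

(* Defs.v *)
From HB Require Import structures.
From mathcomp Require Import all_boot all_order all_algebra finmap.
From mathcomp Require Import all_classical all_reals all_analysis.

Set Implicit Arguments.
Unset Strict Implicit.
Unset Printing Implicit Defensive.

Import Order.TTheory GRing.Theory Num.Theory.
Import numFieldNormedType.Exports.

Local Open Scope classical_set_scope.
Local Open Scope ring_scope.

Definition unitI (R : realType) : set R := `[0, 1].

Definition covers (T : Type) (K : set T) (U : set (set T)) : Prop :=
  K `<=` \bigcup_(V in U) V.

(* The cardinality of a collection is only meaningful when it is finite:
   [fset_set] sends infinite sets to [fset0]. *)
Definition ncard (T : choiceType) (U : set T) : nat := #|` fset_set U|.

Definition open_interval_in_I (R : realType) (U : set R) : Prop :=
  is_interval U /\ exists2 V : set R, open V & U = @unitI R `&` V.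

Definition minimal_open_cover (R : realType) (alpha : set (set R)) : Prop :=
  [/\ finite_set alpha,
      forall U, alpha U -> open_interval_in_I U,
      covers (@unitI R) alpha &
      forall beta : set (set R), beta `<=` alpha ->
        (ncard beta < ncard alpha)%N -> ~ covers (@unitI R) beta].

(* Points of I^(m+1) are functions 'I_m.+1 -> R; for i : 'I_m the indices
   [widen_ord (leqnSn m) i] and [lift ord0 i] have values i and i + 1. *)
Definition star (R : realType) (A : set (R * R)) (m : nat) :
    set ('I_m.+1 -> R) :=
  [set x | (forall j, unitI (x j)) /\
    forall i : 'I_m, A (x (widen_ord (leqnSn m) i), x (lift ord0 i))].
Arguments star {R} A m.

Definition star_inf (R : realType) (A : set (R * R)) : set (nat -> R) :=
  [set x | (forall j, unitI (x j)) /\ forall i, A (x i, x i.+1)].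

Definition cover_power (T : Type) (alpha : set (set T)) (m : nat) :
    set (set ('I_m -> T)) :=
  [set P | exists2 k : 'I_m -> set T,
    forall j, alpha (k j) & P = [set x | forall j, k j (x j)]].
Arguments cover_power {T} alpha m.

Definition subcover_card (T : Type) (K : set T) (U : set (set T)) : set nat :=
  [set n | exists V : set (set T),
    [/\ V `<=` U, finite_set V, covers K V & ncard V = n]].

(* Defaults to 0 when no finite subcollection of U covers K. *)
Definition cover_number (T : Type) (K : set T) (U : set (set T)) : nat :=
  xget 0%N [set n | subcover_card K U n /\
    forall p, subcover_card K U p -> (n <= p)%N].

(* The term of index 0 is junk and does not affect the limit. *)
Definition ent_cover (R : realType) (A : set (R * R)) (alpha : set (set R)) :
    R :=
  if `[< star_inf A !=set0 >] then
    limn (fun m : nat => m%:R^-1 *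
      ln (cover_number (star A m) (cover_power alpha m.+1))%:R : R)
  else 0.

Definition ent (R : realType) (A : set (R * R)) : \bar R :=
  ereal_sup [set (ent_cover A alpha)%:E
            | alpha in [set alpha | minimal_open_cover alpha]].

Definition inv_rel (R : realType) (G : set (R * R)) : set (R * R) :=
  [set p | G (p.2, p.1)].

(* Main.v *)
Require Import Defs.
From HB Require Import structures.
From mathcomp Require Import all_boot all_order all_algebra finmap.
From mathcomp Require Import all_classical all_reals all_analysis.

Set Implicit Arguments.
Unset Strict Implicit.
Unset Printing Implicit Defensive.

Import Order.TTheory GRing.Theory Num.Theory.
Import numFieldNormedType.Exports.
Local Open Scope classical_set_scope.
Local Open Scope ring_scope.

(** Reading a finite orbit backwards, [x |-> x \o rev_ord], is an involution
    of [I^(m+1)] that exchanges the orbits of length [m] of [G] with those of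
    [G^-1] and permutes the boxes of [alpha^(m+1)]. It therefore turns subcovers
    into subcovers of the same cardinality, so that [G] and [G^-1] have the same
    covering numbers for every [m] and every [alpha] ([cover_number_inv_rel]).

    Infinite orbits cannot be read backwards, so reversal alone does not show
    that the convention for an empty space of infinite orbits applies to [G] and
    [G^-1] simultaneously. Here closedness enters: by compactness of the cube
    [I^nat], an infinite orbit exists as soon as there are finite orbits of
    every length ([star_inf_nonempty]), and that condition is invariant under
    reversal. *)

Lemma ncard_image (T T' : choiceType) (f : T -> T') (A : set T) :
  injective f -> finite_set A -> ncard (f @` A) = ncard A.
Proof.
move=> f_inj finA; rewrite /ncard fset_set_image// card_in_imfset//=.
by move=> x y _ _; apply: f_inj.
Qed.

(** Taking preimages under the involution [f] is an injection on subsets, so it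
    transports a subcover of [K] to one of [f @^-1` K] with the same number of
    members. *)
Lemma subcover_card_preimage (T : Type) (f : T -> T) (K : set T)
    (U : set (set T)) :
  involutive f -> (forall B, U B -> U (f @^-1` B)) ->
  subcover_card K U `<=` subcover_card (f @^-1` K) U.
Proof.
move=> fK fU n [V [VU finV KV <-]].
have pre_inj : injective (fun B : set T => f @^-1` B).
  by apply: inv_inj => B; apply/funext => x; rewrite /preimage/= fK.
exists ((fun B : set T => f @^-1` B) @` V); split.
- by move=> _ [B VB <-]; apply/fU/VU.
- exact: finite_image.
- move=> x /KV[B VB Bfx]; exists (f @^-1` B) => //.
  by exists B.
- exact: ncard_image.
Qed.

Lemma cover_number_preimage (T : Type) (f : T -> T) (K : set T)
    (U : set (set T)) :
  involutive f -> (forall B, U B -> U (f @^-1` B)) ->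
  cover_number (f @^-1` K) U = cover_number K U.
Proof.
move=> fK fU; rewrite /cover_number.
suff -> : subcover_card (f @^-1` K) U = subcover_card K U by [].
apply/seteqP; split; last exact: subcover_card_preimage.
have {2}-> : K = f @^-1` (f @^-1` K).
  by apply/funext => x; rewrite /preimage/= fK.
exact: subcover_card_preimage.
Qed.

Definition reverse (T : Type) (n : nat) (x : 'I_n -> T) : 'I_n -> T :=
  x \o @rev_ord n.

Lemma reverseK (T : Type) (n : nat) : involutive (@reverse T n).
Proof. by move=> x; apply/funext => i; rewrite /reverse/= rev_ordK. Qed.

Lemma cover_power_reverse (T : Type) (alpha : set (set T)) (n : nat)
    (B : set ('I_n -> T)) :
  cover_power alpha n B -> cover_power alpha n (@reverse T n @^-1` B).
Proof.
move=> [k alphak ->]; exists (reverse k) => [j|]; first exact: alphak.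
apply/seteqP; split=> x /= kx j; last first.
  by move: (kx (rev_ord j)); rewrite /reverse/= rev_ordK.
by move: (kx (rev_ord j)); rewrite /reverse/= rev_ordK.
Qed.

Lemma inv_relK (R : realType) (G : set (R * R)) : inv_rel (inv_rel G) = G.
Proof. by apply/seteqP; split=> -[]. Qed.

Lemma sub_star_inv_rel (R : realType) (G : set (R * R)) (m : nat) :
  star G m `<=` @reverse R m.+1 @^-1` star (inv_rel G) m.
Proof.
move=> x [xI xG]; split=> [j|i]; first exact: xI.
have e1 : rev_ord (widen_ord (leqnSn m) i) = lift ord0 (rev_ord i).
  by apply: val_inj; rewrite /= /bump/= add1n subSS subnSK.
have e2 : rev_ord (lift ord0 i) = widen_ord (leqnSn m) (rev_ord i).
  by apply: val_inj; rewrite /= /bump/= add1n.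
by rewrite /inv_rel/= /reverse/= e1 e2; exact: xG.
Qed.

Lemma star_inv_rel (R : realType) (G : set (R * R)) (m : nat) :
  star (inv_rel G) m = @reverse R m.+1 @^-1` star G m.
Proof.
apply/seteqP; split=> x.
  by move=> /sub_star_inv_rel; rewrite inv_relK.
by move=> /sub_star_inv_rel; rewrite /preimage/= reverseK.
Qed.

Lemma cover_number_inv_rel (R : realType) (G : set (R * R))
    (alpha : set (set R)) (m : nat) :
  cover_number (star (inv_rel G) m) (cover_power alpha m.+1) =
  cover_number (star G m) (cover_power alpha m.+1).
Proof.
rewrite star_inv_rel; apply: cover_number_preimage; first exact: reverseK.
exact: cover_power_reverse.
Qed.

Lemma star_nonempty (R : realType) (G : set (R * R)) (m : nat) :
  star_inf G !=set0 -> star G m !=set0.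
Proof.
move=> [x [xI xG]]; exists (fun j => x j); split=> [j|i]; first exact: xI.
exact: xG.
Qed.

(** The sequences in [I^nat] whose first [m] steps lie in [G] form a decreasing
    sequence of nonempty closed subsets of a compact space, and a common point
    of all of them is an infinite orbit. *)
Lemma star_inf_nonempty (R : realType) (G : set (R * R)) :
  closed G -> (forall m, star G m !=set0) -> star_inf G !=set0.
Proof.
move=> clG starG.
pose X := prod_topology (fun _ : nat => R : topologicalType).
pose C m := [set x : X | (forall j, unitI (x j)) /\
  forall i, (i < m)%N -> G (x i, x i.+1)].
have C_nonempty m : C m !=set0.
  have [x [xI xG]] := starG m.
  (* The values beyond index [m] only have to lie in [I]; [inord] repeats
     the initial point there. *)
  exists (fun j => x (inord j)); split=> [j|i im]; first exact: xI.
  have -> : inord i = widen_ord (leqnSn m) (Ordinal im).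
    by apply: val_inj; rewrite /= inordK// ltnS ltnW.
  have -> : inord i.+1 = lift ord0 (Ordinal im).
    by apply: val_inj; rewrite /= /bump/= add1n inordK// ltnS.
  exact: xG.
have C_decreasing m n : (m <= n)%N -> C n `<=` C m.
  move=> mn x [xI xG]; split=> // i im.
  exact/xG/(leq_trans im).
pose F := filter_from setT C.
have properF : ProperFilter F.
  apply: filter_from_proper => [|m _]; last exact: C_nonempty.
  apply: filter_from_filter; first by exists 0%N.
  move=> m n _ _; exists (maxn m n) => // x Cx.
  by split; apply: C_decreasing Cx; rewrite ?leq_maxl ?leq_maxr.
have cubeK : compact [set x : X | forall j, unitI (x j)].
  apply: (@tychonoff nat (fun _ => R : topologicalType) (fun _ => @unitI R)).
  by move=> _; exact: segment_compact.
have FX : F [set x : X | forall j, unitI (x j)].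
  by exists 0%N => // x [].
have [p [pI pF]] := cubeK F properF FX.
exists p; split=> [//|i].
have coord_continuous j : continuous ((fun x => x j) : X -> R).
  exact: (@proj_continuous nat (fun _ => R : topologicalType) j).
have step_closed : closed [set x : X | G (x i, x i.+1)].
  apply: (@preimage_closed _ _ (fun x : X => (x i, x i.+1))) clG => x _.
  exact: (cvg_pair (coord_continuous i x) (coord_continuous i.+1 x)).
apply: step_closed => B pB.
by apply: pF pB; exists i.+1 => // x [_ xG]; exact: xG.
Qed.

Lemma closed_inv_rel (R : realType) (G : set (R * R)) :
  closed G -> closed (inv_rel G).
Proof.
move=> clG.
apply: (@preimage_closed _ _ (fun p : R * R => (p.2, p.1))) clG => p _.
exact: (cvg_pair cvg_snd cvg_fst).
Qed.

Lemma star_inf_inv_rel_nonempty (R : realType) (G : set (R * R)) :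
  closed G -> star_inf G !=set0 -> star_inf (inv_rel G) !=set0.
Proof.
move=> clG G0; apply: star_inf_nonempty => [|m]; first exact: closed_inv_rel.
have [x xG] := star_nonempty m G0.
by exists (reverse x); exact: sub_star_inv_rel.
Qed.

Theorem theorem7 (R : realType) (G : set (R * R))
    (clG : closed G) (GI : G `<=` @unitI R `*` @unitI R) :
  ent G = ent (inv_rel G).
Proof.
suff e : ent_cover G = ent_cover (inv_rel G) by rewrite /ent e.
apply/funext => alpha; rewrite /ent_cover.
under [X in _ = if _ then limn X else _]eq_fun do rewrite cover_number_inv_rel.
suff -> : star_inf (inv_rel G) !=set0 = (star_inf G !=set0) by [].
apply/propext; split; last exact: star_inf_inv_rel_nonempty.
move=> /star_inf_inv_rel_nonempty; rewrite inv_relK; apply.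
exact: closed_inv_rel.
Qed.
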